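(* Let $\mathbb{K}$ be a field of characteristic $0$, let $k\geq 1$ be an integer, and let $sl_2=sl_2(\mathbb{K})$ be endowed with the $\mathbb{Z}$-grading $L_{-1}=\mathbb{K}e$, $L_0=\mathbb{K}h$, $L_1=\mathbb{K}f$, $L_i=0$ for $i\notin\{-1,0,1\}$. Then $$\mathrm{GKdim}_k^{\mathbb{Z}}(sl_2)=3k-1.$$
   Context: $sl_2=sl_2(\mathbb{K})$ is the Lie algebra of traceless $2\times 2$ matrices over $\mathbb{K}$, with standard basis $h=\begin{pmatrix}1&0\\0&-1\end{pmatrix}$, $e=\begin{pmatrix}0&1\\0&0\end{pmatrix}$, $f=\begin{pmatrix}0&0\\1&0\end{pmatrix}$. For an abelian group $G$ and a $G$-graded Lie algebra $L=\bigoplus_{g\in G}L_g$ over $\mathbb{K}$ with finite support $\mathrm{Supp}(L)=\{g\in G: L_g\neq 0\}=\{g_1,\ldots,g_s\}$: let $\mathcal{L}(X)$ be the free $G$-graded Lie algebra over $\mathbb{K}$ on $X=\bigcup_{g\in G}X_g$, where the $X_g=\{x_i^g : i\geq 1\}$ are disjoint infinite sets of variables of homogeneous degree $g$. A polynomial $f\in\mathcal{L}(X)$ is a $G$-graded polynomial identity of $L$ if it vanishes under every substitution of the variables $x_i^g$ by elements of $L_g$ (all $g\in G$, $i\ge 1$); $T_G(L)$ is the ideal of all $G$-graded polynomial identities of $L$. The relatively free $G$-graded algebra of $L$ in $k$ variables is $$\mathcal{L}_k^G(L)=\frac{\mathcal{L}(x_1^{g_1},\ldots,x_k^{g_1},\ldots,x_1^{g_s},\ldots,x_k^{g_s})}{\mathcal{L}(x_1^{g_1},\ldots,x_k^{g_1},\ldots,x_1^{g_s},\ldots,x_k^{g_s})\cap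 T_G(L)},$$ where $\mathcal{L}(x_1^{g_1},\ldots,x_k^{g_s})$ denotes the free Lie algebra on the listed $sk$ variables. For an algebra $A$ generated by a finite set $V$, the growth function $g_V(m)$ is the dimension of the span of all words of length at most $m$ in the elements of $V$, and $\mathrm{GKdim}(A)=\limsup_{m\to\infty}\frac{\ln g_V(m)}{\ln m}$ (independent of $V$). The $G$-graded Gelfand-Kirillov dimension of $L$ in $k$ variables is $\mathrm{GKdim}_k^G(L):=\mathrm{GKdim}(\mathcal{L}_k^G(L))$. *)

(* Defs.v *)
From HB Require Import structures.
From mathcomp Require Import all_boot all_order all_algebra.
From mathcomp Require Import ring.
From mathcomp Require Import all_classical all_reals all_analysis.

Set Implicit Arguments.
Unset Strict Implicit.
Unset Printing Implicit Defensive.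

Import Order.TTheory GRing.Theory Num.Theory.

Local Open Scope quotient_scope.
Local Open Scope classical_set_scope.
Local Open Scope ring_scope.

HB.mixin Record isLieAlgebra (K : fieldType) L of GRing.Lmodule K L := {
  lie : L -> L -> L;
  lieDl : forall x y z : L, lie (x + y) z = lie x z + lie y z;
  lieZl : forall (a : K) (x z : L), lie (a *: x) z = a *: lie x z;
  lieDr : forall z x y : L, lie z (x + y) = lie z x + lie z y;
  lieZr : forall (a : K) (z x : L), lie z (a *: x) = a *: lie z x;
  liexx : forall x : L, lie x x = 0;
  lie_jacobi : forall x y z : L,
    lie x (lie y z) + lie y (lie z x) + lie z (lie x y) = 0
}.

#[short(type="lieAlgType")]
HB.structure Definition LieAlgebra (K : fieldType) :=
  {L of GRing.Lmodule K L & isLieAlgebra K L}.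

Section LieTheory.
Variables (K : fieldType) (L : lieAlgType K).
Implicit Types x y : L.

Lemma lie0l x : lie 0 x = 0.
Proof. by rewrite -[X in lie X _](scale0r 0) lieZl scale0r. Qed.
Lemma lie0r x : lie x 0 = 0.
Proof. by rewrite -[X in lie _ X](scale0r 0) lieZr scale0r. Qed.
Lemma lieNl x y : lie (- x) y = - lie x y.
Proof. by rewrite -!scaleN1r lieZl. Qed.
Lemma lieNr x y : lie x (- y) = - lie x y.
Proof. by rewrite -!scaleN1r lieZr. Qed.
Lemma lieBl x y z : lie (x - y) z = lie x z - lie y z.
Proof. by rewrite lieDl lieNl. Qed.
Lemma lieBr x y z : lie z (x - y) = lie z x - lie z y.
Proof. by rewrite lieDr lieNr. Qed.
Lemma lieC x y : lie x y = - lie y x.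
Proof.
apply/eqP; rewrite -addr_eq0; apply/eqP.
by have := liexx (x + y); rewrite lieDl !lieDr !liexx add0r addr0.
Qed.

End LieTheory.

(* Free Lie algebra on X: formal expressions modulo the congruence generated
   by the axioms of Lie algebras over K. *)
Section FreeLie.
Variables (K : fieldType) (X : Type).

Inductive lterm : Type :=
| LVar of X
| LZero
| LAdd of lterm & lterm
| LScale of K & lterm
| LBr of lterm & lterm.

HB.instance Definition _ := gen_eqMixin lterm.
HB.instance Definition _ := gen_choiceMixin lterm.

Inductive lteq : lterm -> lterm -> Prop :=
| lteq_refl t : lteq t t
| lteq_sym t u : lteq t u -> lteq u t
| lteq_trans t u v : lteq t u -> lteq u v -> lteq t v
| lteq_add t t' u u' :
    lteq t t' -> lteq u u' -> lteq (LAdd t u) (LAdd t' u')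
| lteq_scale a t t' : lteq t t' -> lteq (LScale a t) (LScale a t')
| lteq_br t t' u u' :
    lteq t t' -> lteq u u' -> lteq (LBr t u) (LBr t' u')
| lteq_addA t u v : lteq (LAdd t (LAdd u v)) (LAdd (LAdd t u) v)
| lteq_addC t u : lteq (LAdd t u) (LAdd u t)
| lteq_add0 t : lteq (LAdd LZero t) t
| lteq_addN t : lteq (LAdd (LScale (-1) t) t) LZero
| lteq_scaleA a b t : lteq (LScale a (LScale b t)) (LScale (a * b) t)
| lteq_scale1 t : lteq (LScale 1 t) t
| lteq_scaleDr a t u :
    lteq (LScale a (LAdd t u)) (LAdd (LScale a t) (LScale a u))
| lteq_scaleDl a b t :
    lteq (LScale (a + b) t) (LAdd (LScale a t) (LScale b t))
| lteq_brDl t u v : lteq (LBr (LAdd t u) v) (LAdd (LBr t v) (LBr u v))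
| lteq_brZl a t v : lteq (LBr (LScale a t) v) (LScale a (LBr t v))
| lteq_brDr v t u : lteq (LBr v (LAdd t u)) (LAdd (LBr v t) (LBr v u))
| lteq_brZr a v t : lteq (LBr v (LScale a t)) (LScale a (LBr v t))
| lteq_brxx t : lteq (LBr t t) LZero
| lteq_jacobi t u v :
    lteq (LAdd (LAdd (LBr t (LBr u v)) (LBr u (LBr v t))) (LBr v (LBr t u)))
         LZero.

Definition lteqb (t u : lterm) : bool := `[< lteq t u >].

Lemma lteqb_equiv : equiv_class_of lteqb.
Proof.
split=> [t|t u|u t v].
- by apply/asboolP; exact: lteq_refl.
- by apply/asboolP/asboolP => ?; exact: lteq_sym.
- by move=> /asboolP tu /asboolP uv; apply/asboolP; exact: lteq_trans tu uv.
Qed.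

Canonical lteqb_equivRel := EquivRelPack lteqb_equiv.
Canonical lteqb_encModRel := defaultEncModRel lteqb.

Definition freeLie : Type := {eq_quot lteqb}.
HB.instance Definition _ : EqQuotient lterm lteqb freeLie :=
  EqQuotient.on freeLie.
HB.instance Definition _ := Choice.on freeLie.

Local Notation pi := (\pi_freeLie).

Lemma freeLie_eqP (t u : lterm) : pi t = pi u <-> lteq t u.
Proof.
split=> [/eqP|tu]; first by rewrite eqmodE => /asboolP.
by apply/eqP; rewrite eqmodE; apply/asboolP.
Qed.

Lemma lteq_repr (t : lterm) : lteq (repr (pi t)) t.
Proof. by apply/freeLie_eqP; rewrite reprK. Qed.

Lemma freeLieW (P : freeLie -> Prop) :
  (forall t, P (pi t)) -> forall x, P x.
Proof. by move=> Ppi x; rewrite -[x]reprK. Qed.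

Definition freeLie_add (x y : freeLie) : freeLie := pi (LAdd (repr x) (repr y)).
Definition freeLie_scale (a : K) (x : freeLie) : freeLie :=
  pi (LScale a (repr x)).
Definition freeLie_br (x y : freeLie) : freeLie := pi (LBr (repr x) (repr y)).

Lemma pi_addE t u : freeLie_add (pi t) (pi u) = pi (LAdd t u).
Proof. by apply/freeLie_eqP; apply: lteq_add; exact: lteq_repr. Qed.
Lemma pi_scaleE a t : freeLie_scale a (pi t) = pi (LScale a t).
Proof. by apply/freeLie_eqP; apply: lteq_scale; exact: lteq_repr. Qed.
Lemma pi_brE t u : freeLie_br (pi t) (pi u) = pi (LBr t u).
Proof. by apply/freeLie_eqP; apply: lteq_br; exact: lteq_repr. Qed.

Let piE := (pi_addE, pi_scaleE, pi_brE).

Let addA : associative freeLie_add.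
Proof.
elim/freeLieW=> t; elim/freeLieW=> u; elim/freeLieW=> v; rewrite !piE.
by apply/freeLie_eqP; exact: lteq_addA.
Qed.
Let addC : commutative freeLie_add.
Proof.
elim/freeLieW=> t; elim/freeLieW=> u; rewrite !piE.
by apply/freeLie_eqP; exact: lteq_addC.
Qed.
Let add0 : left_id (pi LZero) freeLie_add.
Proof.
by elim/freeLieW=> t; rewrite !piE; apply/freeLie_eqP; exact: lteq_add0.
Qed.
Let addN : left_inverse (pi LZero) (freeLie_scale (-1)) freeLie_add.
Proof.
by elim/freeLieW=> t; rewrite !piE; apply/freeLie_eqP; exact: lteq_addN.
Qed.

HB.instance Definition _ := GRing.isZmodule.Build freeLie addA addC add0 addN.

Let scaleA (a b : K) (x : freeLie) :
  freeLie_scale a (freeLie_scale b x) = freeLie_scale (a * b) x.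
Proof.
by elim/freeLieW: x => t; rewrite !piE; apply/freeLie_eqP; exact: lteq_scaleA.
Qed.
Let scale1 : left_id 1 freeLie_scale.
Proof.
by elim/freeLieW=> t; rewrite !piE; apply/freeLie_eqP; exact: lteq_scale1.
Qed.
Let scaleDr : right_distributive freeLie_scale +%R.
Proof.
move=> a; elim/freeLieW=> t; elim/freeLieW=> u.
by rewrite /GRing.add /= !piE; apply/freeLie_eqP; exact: lteq_scaleDr.
Qed.
Let scaleDl (x : freeLie) : {morph freeLie_scale^~ x : a b / a + b}.
Proof.
move=> a b; elim/freeLieW: x => t.
by rewrite [in RHS]/GRing.add /= !piE; apply/freeLie_eqP; exact: lteq_scaleDl.
Qed.

HB.instance Definition _ :=
  GRing.Zmodule_isLmodule.Build K freeLie scaleA scale1 scaleDr scaleDl.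

Lemma piD t u : pi (LAdd t u) = pi t + pi u. Proof. by rewrite -pi_addE. Qed.
Lemma piZ a t : pi (LScale a t) = a *: pi t. Proof. by rewrite -pi_scaleE. Qed.
Lemma pi0 : pi LZero = 0. Proof. by []. Qed.

Let brDl x y z :
  freeLie_br (x + y) z = freeLie_br x z + freeLie_br y z.
Proof.
elim/freeLieW: x => t; elim/freeLieW: y => u; elim/freeLieW: z => v.
by rewrite -piD !piE -piD; apply/freeLie_eqP; exact: lteq_brDl.
Qed.
Let brZl (a : K) x z : freeLie_br (a *: x) z = a *: freeLie_br x z.
Proof.
elim/freeLieW: x => t; elim/freeLieW: z => v.
by rewrite -piZ !piE -piZ; apply/freeLie_eqP; exact: lteq_brZl.
Qed.
Let brDr z x y : freeLie_br z (x + y) = freeLie_br z x + freeLie_br z y.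
Proof.
elim/freeLieW: x => t; elim/freeLieW: y => u; elim/freeLieW: z => v.
by rewrite -piD !piE -piD; apply/freeLie_eqP; exact: lteq_brDr.
Qed.
Let brZr (a : K) z x : freeLie_br z (a *: x) = a *: freeLie_br z x.
Proof.
elim/freeLieW: x => t; elim/freeLieW: z => v.
by rewrite -piZ !piE -piZ; apply/freeLie_eqP; exact: lteq_brZr.
Qed.
Let brxx x : freeLie_br x x = 0.
Proof.
by elim/freeLieW: x => t; rewrite piE -pi0; apply/freeLie_eqP; exact: lteq_brxx.
Qed.
Let jacobi x y z :
  freeLie_br x (freeLie_br y z) + freeLie_br y (freeLie_br z x)
    + freeLie_br z (freeLie_br x y) = 0.
Proof.
elim/freeLieW: x => t; elim/freeLieW: y => u; elim/freeLieW: z => v.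
by rewrite !piE -!piD -pi0; apply/freeLie_eqP; exact: lteq_jacobi.
Qed.

HB.instance Definition _ :=
  isLieAlgebra.Build K freeLie brDl brZl brDr brZr brxx jacobi.

Lemma pi_lie t u : pi (LBr t u) = lie (pi t) (pi u).
Proof. by rewrite -pi_brE. Qed.

Definition fgen (x : X) : freeLie := pi (LVar x).

Section Lift.
Variables (L : lieAlgType K) (s : X -> L).

Fixpoint lteval (t : lterm) : L :=
  match t with
  | LVar x => s x
  | LZero => 0
  | LAdd t u => lteval t + lteval u
  | LScale a t => a *: lteval t
  | LBr t u => lie (lteval t) (lteval u)
  end.

Lemma lteval_eq t u : lteq t u -> lteval t = lteval u.
Proof.
elim=> //=.
- by move=> ? ? ? _ -> _ ->.
- by move=> ? ? ? ? _ -> _ ->.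
- by move=> ? ? ? _ ->.
- by move=> ? ? ? ? _ -> _ ->.
- by move=> *; rewrite addrA.
- by move=> *; rewrite addrC.
- by move=> *; rewrite add0r.
- by move=> *; rewrite scaleN1r addNr.
- by move=> *; rewrite scalerA.
- by move=> *; rewrite scale1r.
- by move=> *; rewrite scalerDr.
- by move=> *; rewrite scalerDl.
- by move=> *; rewrite lieDl.
- by move=> *; rewrite lieZl.
- by move=> *; rewrite lieDr.
- by move=> *; rewrite lieZr.
- by move=> *; rewrite liexx.
- by move=> *; rewrite lie_jacobi.
Qed.

(* The substitution morphism x |-> s x from the free Lie algebra to L. *)
Definition flift (p : freeLie) : L := lteval (repr p).

Lemma flift_pi t : flift (pi t) = lteval t.
Proof. by apply: lteval_eq; exact: lteq_repr. Qed.

Lemma flift_gen x : flift (fgen x) = s x.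
Proof. exact: flift_pi. Qed.
Lemma flift0 : flift 0 = 0.
Proof. by rewrite -pi0 flift_pi. Qed.
Lemma fliftD p q : flift (p + q) = flift p + flift q.
Proof.
by elim/freeLieW: p => t; elim/freeLieW: q => u; rewrite -piD !flift_pi.
Qed.
Lemma fliftZ a p : flift (a *: p) = a *: flift p.
Proof. by elim/freeLieW: p => t; rewrite -piZ !flift_pi. Qed.
Lemma flift_lie p q : flift (lie p q) = lie (flift p) (flift q).
Proof.
by elim/freeLieW: p => t; elim/freeLieW: q => u; rewrite -pi_lie !flift_pi.
Qed.

Lemma flift_uniq (phi : freeLie -> L) :
  (forall p q, phi (p + q) = phi p + phi q) ->
  (forall a p, phi (a *: p) = a *: phi p) ->
  (forall p q, phi (lie p q) = lie (phi p) (phi q)) ->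
  (forall x, phi (fgen x) = s x) ->
  phi =1 flift.
Proof.
move=> phiD phiZ phiB phiG; elim/freeLieW; elim=> [x||t IHt u IHu|a t IHt|t IHt u IHu].
- by rewrite [phi _]phiG flift_pi.
- by rewrite pi0 flift0 -[X in phi X](scale0r 0) phiZ scale0r.
- by rewrite piD phiD fliftD IHt IHu.
- by rewrite piZ phiZ fliftZ IHt.
- by rewrite pi_lie phiB flift_lie IHt IHu.
Qed.

End Lift.
End FreeLie.

Definition is_subspace (K : fieldType) (V : lmodType K) (S : set V) : Prop :=
  [/\ S 0, (forall x y, S x -> S y -> S (x + y))
    & (forall (a : K) x, S x -> S (a *: x))].

Record lieIdeal (K : fieldType) (L : lieAlgType K) := LieIdeal {
  ideal_set :> L -> Prop;
  ideal_subspace : is_subspace ideal_set;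
  ideal_lie : forall x y : L, ideal_set y -> ideal_set (lie x y)
}.

Section LieQuotient.
Variables (K : fieldType) (L : lieAlgType K) (J : lieIdeal L).

Definition ideal_mem : {pred L} := fun x => `[< J x >].
Local Notation I := ideal_mem.

Lemma ideal_memP x : x \in I <-> J x.
Proof. by split=> /asboolP. Qed.

Lemma ideal_mem_submod : GRing.subsemimod_closed I.
Proof.
have [J0 JD JZ] := ideal_subspace J.
split; first split.
- exact/ideal_memP.
- by move=> x y /ideal_memP xJ /ideal_memP yJ; apply/ideal_memP; exact: JD.
- by move=> a x /ideal_memP xJ; apply/ideal_memP; exact: JZ.
Qed.
HB.instance Definition _ := GRing.isSubmodClosed.Build K L I ideal_mem_submod.

Lemma lie_idealr (x y : L) : y \in I -> lie x y \in I.
Proof. by move=> /ideal_memP yJ; apply/ideal_memP; exact: ideal_lie. Qed.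
Lemma lie_ideall (x y : L) : x \in I -> lie x y \in I.
Proof. by move=> xI; rewrite lieC rpredN; exact: lie_idealr. Qed.

Definition lieQuot : Type := Quotient.quot I.
HB.instance Definition _ := GRing.Zmodule.on lieQuot.

Definition lieProj (x : L) : lieQuot := \pi_(Quotient.quot I) x.

Lemma lieProj_memP x y : lieProj x = lieProj y <-> x - y \in I.
Proof. by rewrite (Quotient.idealrBE I); split=> [/eqP|/eqP]. Qed.

Lemma lieProj_eqP x y : lieProj x = lieProj y <-> J (x - y).
Proof. by rewrite -ideal_memP; exact: lieProj_memP. Qed.

Lemma lieProjK (x : lieQuot) : lieProj (repr x) = x.
Proof. exact: reprK. Qed.

Lemma lieProjW (P : lieQuot -> Prop) : (forall x, P (lieProj x)) -> forall x, P x.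
Proof. by move=> PI x; rewrite -[x]lieProjK. Qed.

Lemma lieProjD x y : lieProj (x + y) = lieProj x + lieProj y.
Proof. exact: raddfD. Qed.

Definition lieQuot_scale (a : K) (x : lieQuot) : lieQuot :=
  lieProj (a *: repr x).
Definition lieQuot_lie (x y : lieQuot) : lieQuot :=
  lieProj (lie (repr x) (repr y)).

Lemma lieProj_scaleE a x : lieQuot_scale a (lieProj x) = lieProj (a *: x).
Proof.
by apply/lieProj_memP; rewrite -scalerBr rpredZ //; apply/lieProj_memP/lieProjK.
Qed.

Lemma lieProj_lieE x y : lieQuot_lie (lieProj x) (lieProj y) = lieProj (lie x y).
Proof.
apply/lieProj_memP; set x' := repr _; set y' := repr _.
have -> : lie x' y' - lie x y = lie (x' - x) y' + lie x (y' - y).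
  by rewrite lieBl lieBr addrA subrK.
by apply: rpredD; [apply: lie_ideall|apply: lie_idealr];
  apply/lieProj_memP/lieProjK.
Qed.

Let scaleA (a b : K) (x : lieQuot) :
  lieQuot_scale a (lieQuot_scale b x) = lieQuot_scale (a * b) x.
Proof. by elim/lieProjW: x => x; rewrite !lieProj_scaleE scalerA. Qed.
Let scale1 : left_id 1 lieQuot_scale.
Proof. by elim/lieProjW=> x; rewrite lieProj_scaleE scale1r. Qed.
Let scaleDr : right_distributive lieQuot_scale +%R.
Proof.
move=> a; elim/lieProjW=> x; elim/lieProjW=> y.
by rewrite -lieProjD !lieProj_scaleE -lieProjD scalerDr.
Qed.
Let scaleDl (x : lieQuot) : {morph lieQuot_scale^~ x : a b / a + b}.
Proof.
move=> a b; elim/lieProjW: x => x.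
by rewrite !lieProj_scaleE -lieProjD scalerDl.
Qed.

HB.instance Definition _ :=
  GRing.Zmodule_isLmodule.Build K lieQuot scaleA scale1 scaleDr scaleDl.

Lemma lieProjZ a x : lieProj (a *: x) = a *: lieProj x.
Proof. by rewrite -lieProj_scaleE. Qed.
Lemma lieProj0 : lieProj 0 = 0.
Proof. exact: raddf0. Qed.

Let qDl x y z : lieQuot_lie (x + y) z = lieQuot_lie x z + lieQuot_lie y z.
Proof.
elim/lieProjW: x => x; elim/lieProjW: y => y; elim/lieProjW: z => z.
by rewrite -lieProjD !lieProj_lieE -lieProjD lieDl.
Qed.
Let qZl (a : K) x z : lieQuot_lie (a *: x) z = a *: lieQuot_lie x z.
Proof.
elim/lieProjW: x => x; elim/lieProjW: z => z.
by rewrite -lieProjZ !lieProj_lieE -lieProjZ lieZl.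
Qed.
Let qDr z x y : lieQuot_lie z (x + y) = lieQuot_lie z x + lieQuot_lie z y.
Proof.
elim/lieProjW: x => x; elim/lieProjW: y => y; elim/lieProjW: z => z.
by rewrite -lieProjD !lieProj_lieE -lieProjD lieDr.
Qed.
Let qZr (a : K) z x : lieQuot_lie z (a *: x) = a *: lieQuot_lie z x.
Proof.
elim/lieProjW: x => x; elim/lieProjW: z => z.
by rewrite -lieProjZ !lieProj_lieE -lieProjZ lieZr.
Qed.
Let qxx x : lieQuot_lie x x = 0.
Proof. by elim/lieProjW: x => x; rewrite lieProj_lieE liexx lieProj0. Qed.
Let qjacobi x y z :
  lieQuot_lie x (lieQuot_lie y z) + lieQuot_lie y (lieQuot_lie z x)
    + lieQuot_lie z (lieQuot_lie x y) = 0.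
Proof.
elim/lieProjW: x => x; elim/lieProjW: y => y; elim/lieProjW: z => z.
by rewrite !lieProj_lieE -!lieProjD lie_jacobi lieProj0.
Qed.

HB.instance Definition _ :=
  isLieAlgebra.Build K lieQuot qDl qZl qDr qZr qxx qjacobi.

Lemma lieProj_lie x y : lieProj (lie x y) = lie (lieProj x) (lieProj y).
Proof. by rewrite -lieProj_lieE. Qed.

End LieQuotient.

Section Growth.
Variable K : fieldType.

Definition is_lie_subalgebra (L : lieAlgType K) (S : set L) : Prop :=
  is_subspace S /\ (forall x y, S x -> S y -> S (lie x y)).

Definition lspan (V : lmodType K) (S : set V) : set V := smallest (@is_subspace K V) S.

Definition lin_indep (V : lmodType K) n (b : 'I_n -> V) : Prop :=
  forall c : 'I_n -> K, \sum_(i < n) c i *: b i = 0 -> forall i, c i = 0.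

(* Dimension of a finite-dimensional subspace (0 by convention when there is no
   finite basis). *)
Definition ldim (V : lmodType K) (S : set V) : nat :=
  xget 0%N [set n : nat | exists b : 'I_n -> V, lin_indep b /\ lspan (range b) = S].

Variable A : lieAlgType K.

(* lie_word V n x: x is the value of some bracketed monomial of length n in the
   elements of V. *)
Inductive lie_word (V : set A) : nat -> A -> Prop :=
| lie_word1 v : V v -> lie_word V 1 v
| lie_wordM m n x y :
    lie_word V m x -> lie_word V n y -> lie_word V (m + n) (lie x y).

Definition growth (V : set A) (m : nat) : nat :=
  ldim (lspan [set x | exists2 n, (n <= m)%N & lie_word V n x]).

Definition lie_generates (V : set A) : Prop :=
  smallest (@is_lie_subalgebra A) V = setT.

Variable R : realType.

Definition GKdim_wrt (V : set A) : \bar R :=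
  limn_esup (fun m => (ln (growth V m)%:R / ln m%:R)%:E).

(* The common value of GKdim_wrt V over all finite generating sets V; +oo by
   convention when A is not finitely generated. *)
Definition GKdim : \bar R :=
  xget +oo%E [set GKdim_wrt V | V in [set V | finite_set V /\ lie_generates V]].

End Growth.

Section Graded.
Variables (K : fieldType) (G : zmodType).

Record lieGrading (L : lieAlgType K) := LieGrading {
  gcomp :> G -> set L;
  gcomp_subspace : forall g, is_subspace (gcomp g);
  gcomp_lie : forall g h x y, gcomp g x -> gcomp h y -> gcomp (g + h) (lie x y);
  gcomp_sum : forall x : L, exists (s : seq G) (c : G -> L),
    (forall g, gcomp g (c g)) /\ x = \sum_(g <- s) c g;
  gcomp_direct : forall (s : seq G) (c : G -> L), uniq s ->
    (forall g, gcomp g (c g)) -> \sum_(g <- s) c g = 0 ->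
    forall g, g \in s -> c g = 0
}.

Variables (L : lieAlgType K) (Gam : lieGrading L).

Definition gsupport : set G := [set g | exists2 x, Gam g x & x != 0].

(* The variable x_i^g is the pair (g, i); indices start at 0. *)
Definition graded_identity (f : freeLie K (G * nat)) : Prop :=
  forall s : G * nat -> L, (forall g i, Gam g (s (g, i))) -> flift s f = 0.

Definition relvars (k : nat) : set (G * nat) := gsupport `*` [set i | (i < k)%N].

Definition relvars_incl (k : nat) : freeLie K (relvars k) -> freeLie K (G * nat) :=
  flift (fun v : relvars k => fgen K (val v)).

(* L(x_1^{g_1}, ..., x_k^{g_s}) \cap T_G(L), as an ideal of
   L(x_1^{g_1}, ..., x_k^{g_s}). *)
Definition relideal_set (k : nat) : set (freeLie K (relvars k)) :=
  [set f | graded_identity (relvars_incl f)].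

Lemma relideal_subspace k : is_subspace (@relideal_set k).
Proof.
rewrite /relideal_set /relvars_incl; split=> /=.
- by move=> s sG; rewrite !flift0.
- by move=> f g fI gI s sG; rewrite !fliftD fI // gI // addr0.
- by move=> a f fI s sG; rewrite !fliftZ fI // scaler0.
Qed.

Lemma relideal_lie k (f g : freeLie K (relvars k)) :
  relideal_set g -> relideal_set (lie f g).
Proof. by move=> gI s sG; rewrite /relvars_incl !flift_lie gI // lie0r. Qed.

Definition relideal (k : nat) : lieIdeal (freeLie K (relvars k)) :=
  LieIdeal (relideal_subspace k) (@relideal_lie k).

Definition relfree (k : nat) : lieAlgType K := lieQuot (relideal k).

Definition relgen (k : nat) (v : relvars k) : relfree k :=
  lieProj (relideal k) (fgen K v).

Lemma relgen_generates k : lie_generates (range (@relgen k)).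
Proof.
apply/seteqP; split=> // x _ S [[[S0 SD SZ] SL] gS].
elim/lieProjW: x; elim/freeLieW; elim=> [v||t IHt u IHu|a t IHt|t IHt u IHu].
- by apply: gS; exists v.
- by rewrite pi0 lieProj0.
- by rewrite piD lieProjD; exact: SD.
- by rewrite piZ lieProjZ; exact: SZ.
- by rewrite pi_lie lieProj_lie; exact: SL.
Qed.

Lemma relgen_finite k : finite_set gsupport -> finite_set (range (@relgen k)).
Proof.
move=> fS; apply: finite_image.
rewrite (eq_finite_set (card_setT (relvars k))).
by apply: finite_setX => //; exact: finite_II.
Qed.

Definition graded_GKdim (R : realType) (k : nat) : \bar R := GKdim (relfree k) R.

End Graded.

Section Sl2.
Variable K : fieldType.

Definition traceless : {pred 'M[K]_2} := fun A => \tr A == 0.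

Lemma traceless_submod : GRing.subsemimod_closed traceless.
Proof.
split; first split.
- by rewrite unfold_in mxtrace0.
- by move=> A B /eqP A0 /eqP B0; rewrite unfold_in mxtraceD A0 B0 addr0.
- by move=> a A /eqP A0; rewrite unfold_in mxtraceZ A0 mulr0.
Qed.
HB.instance Definition _ :=
  GRing.isSubmodClosed.Build K 'M[K]_2 traceless traceless_submod.

Record sl2 : Type := Sl2 { sl2_mx :> 'M[K]_2; sl2_mxP : sl2_mx \in traceless }.
HB.instance Definition _ := [isSub of sl2 for sl2_mx].
HB.instance Definition _ := [Choice of sl2 by <:].
HB.instance Definition _ := [SubChoice_isSubLmodule of sl2 by <:].

Lemma sl2_lie_subproof (x y : sl2) :
  sl2_mx x *m sl2_mx y - sl2_mx y *m sl2_mx x \in traceless.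
Proof. by rewrite unfold_in raddfB /= mxtrace_mulC subrr. Qed.
Definition sl2_lie (x y : sl2) : sl2 := Sl2 (sl2_lie_subproof x y).

Let sDl x y z : sl2_lie (x + y) z = sl2_lie x z + sl2_lie y z.
Proof.
by apply/val_inj; rewrite /= mulmxDl mulmxDr opprD addrACA.
Qed.
Let sZl (a : K) x z : sl2_lie (a *: x) z = a *: sl2_lie x z.
Proof. by apply/val_inj; rewrite /= -scalemxAl -scalemxAr scalerBr. Qed.
Let sDr z x y : sl2_lie z (x + y) = sl2_lie z x + sl2_lie z y.
Proof.
by apply/val_inj; rewrite /= mulmxDl mulmxDr opprD addrACA.
Qed.
Let sZr (a : K) z x : sl2_lie z (a *: x) = a *: sl2_lie z x.
Proof. by apply/val_inj; rewrite /= -scalemxAl -scalemxAr scalerBr. Qed.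
Let sxx x : sl2_lie x x = 0.
Proof. by apply/val_inj; rewrite /= subrr. Qed.
Let sjacobi x y z :
  sl2_lie x (sl2_lie y z) + sl2_lie y (sl2_lie z x)
    + sl2_lie z (sl2_lie x y) = 0.
Proof.
apply/val_inj; rewrite /= !mulmxBl !mulmxBr !mulmxA.
move: (sl2_mx x) (sl2_mx y) (sl2_mx z) => {x y z} x y z.
move: (x *m y *m z) (x *m z *m y) (y *m x *m z) => a b c.
move: (y *m z *m x) (z *m x *m y) (z *m y *m x) => d e f.
by apply/matrixP => i j; rewrite !mxE; ring.
Qed.

HB.instance Definition _ :=
  isLieAlgebra.Build K sl2 sDl sZl sDr sZr sxx sjacobi.

Lemma sl2_h_subproof : delta_mx 0 0 - delta_mx 1 1 \in traceless.
Proof.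
by rewrite unfold_in /mxtrace !big_ord_recl big_ord0 !mxE /= subr0 sub0r addr0 subrr.
Qed.
Lemma sl2_e_subproof : delta_mx 0 1 \in traceless.
Proof. by rewrite unfold_in /mxtrace !big_ord_recl big_ord0 !mxE /= !addr0. Qed.
Lemma sl2_f_subproof : delta_mx 1 0 \in traceless.
Proof. by rewrite unfold_in /mxtrace !big_ord_recl big_ord0 !mxE /= !addr0. Qed.

Definition sl2_h : sl2 := Sl2 sl2_h_subproof.
Definition sl2_e : sl2 := Sl2 sl2_e_subproof.
Definition sl2_f : sl2 := Sl2 sl2_f_subproof.

Definition sl2_comp (i : int) : set sl2 :=
  if i == -1 then [set a *: sl2_e | a in [set: K]]
  else if i == 0 then [set a *: sl2_h | a in [set: K]]
  else if i == 1 then [set a *: sl2_f | a in [set: K]]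
  else [set 0].

Let I2P (r : 'I_2) : r = 0 \/ r = 1.
Proof. by case: r => -[|[|//]] ri; [left|right]; apply/val_inj. Qed.

Lemma sl2_mx11 (x : sl2) : sl2_mx x 1 1 = - sl2_mx x 0 0.
Proof.
apply/eqP; rewrite -addr_eq0 addrC; apply/eqP.
have := sl2_mxP x; rewrite unfold_in /mxtrace !big_ord_recl big_ord0 addr0.
by move=> /eqP; congr (_ + sl2_mx x _ _ = 0); apply/val_inj.
Qed.

Lemma sl2P (x y : sl2) : sl2_mx x 0 0 = sl2_mx y 0 0 ->
  sl2_mx x 0 1 = sl2_mx y 0 1 -> sl2_mx x 1 0 = sl2_mx y 1 0 -> x = y.
Proof.
move=> h00 h01 h10; apply/val_inj/matrixP => r c /=.
by have [->|->] := I2P r; have [->|->] := I2P c; rewrite // !sl2_mx11 h00.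
Qed.

Lemma sl2_compP i (x : sl2) :
  sl2_comp i x <->
  forall r c : 'I_2, i != (r : nat)%:Z - (c : nat)%:Z -> sl2_mx x r c = 0.
Proof.
rewrite /sl2_comp; split.
- case: eqP => [->|_]; last case: eqP => [->|_]; last case: eqP => [->|_];
    [case=> a _ <-..|move=> -> r c _; by rewrite /= mxE];
    move=> r c; have [->|->] := I2P r; have [->|->] := I2P c => //= _;
    by rewrite !mxE /= ?subr0 ?mulr0.
- move=> H.
  case: eqP => [i1|/eqP i1]; last case: eqP => [i0|/eqP i0];
    last case: eqP => [i1'|/eqP i1'].
  + by exists (sl2_mx x 0 1) => //; apply/esym/sl2P;
      rewrite /= !mxE /= ?mulr0 ?mulr1 //; apply: H; rewrite i1.
  + by exists (sl2_mx x 0 0) => //; apply/esym/sl2P;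
      rewrite /= !mxE /= ?subr0 ?mulr0 ?mulr1 //; apply: H; rewrite i0.
  + by exists (sl2_mx x 1 0) => //; apply/esym/sl2P;
      rewrite /= !mxE /= ?mulr0 ?mulr1 ?subr0 ?mulr0 //; apply: H; rewrite i1'.
  + by apply: sl2P; rewrite /= mxE; apply: H.
Qed.

Lemma sl2_comp_subspace i : is_subspace (sl2_comp i).
Proof.
split.
- by apply/sl2_compP => r c _; rewrite /= mxE.
- move=> x y /sl2_compP xi /sl2_compP yi; apply/sl2_compP => r c irc.
  by rewrite /= mxE xi // yi // addr0.
- move=> a x /sl2_compP xi; apply/sl2_compP => r c irc.
  by rewrite /= mxE xi // mulr0.
Qed.

Lemma sl2_comp_lie i j x y :
  sl2_comp i x -> sl2_comp j y -> sl2_comp (i + j) (lie x y).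
Proof.
move=> /sl2_compP xi /sl2_compP yj; apply/sl2_compP => r c ijrc.
rewrite /= !mxE !big1 ?subrr // => k _.
- have [jrk|/yj -> //] := eqVneq j ((r : nat)%:Z - (k : nat)%:Z); last first.
    by rewrite mul0r.
  rewrite [X in _ * X]xi ?mulr0 //; apply: contra ijrc => /eqP ->.
  by rewrite jrk; apply/eqP; ring.
- have [irk|/xi -> //] := eqVneq i ((r : nat)%:Z - (k : nat)%:Z); last first.
    by rewrite mul0r.
  rewrite [X in _ * X]yj ?mulr0 //; apply: contra ijrc => /eqP ->.
  by rewrite irk; apply/eqP; ring.
Qed.

Lemma sl2_mx_sum (s : seq int) (F : int -> sl2) r c :
  sl2_mx (\sum_(g <- s) F g) r c = \sum_(g <- s) sl2_mx (F g) r c.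
Proof.
elim: s => [|g s IH]; first by rewrite !big_nil /= mxE.
by rewrite !big_cons /= mxE IH.
Qed.

Lemma sl2_comp_sum (x : sl2) : exists (s : seq int) (F : int -> sl2),
  (forall g, sl2_comp g (F g)) /\ x = \sum_(g <- s) F g.
Proof.
pose F (g : int) : sl2 :=
  if g == -1 then sl2_mx x 0 1 *: sl2_e else if g == 0 then sl2_mx x 0 0 *: sl2_h
  else if g == 1 then sl2_mx x 1 0 *: sl2_f else 0.
exists [:: -1; 0; 1], F; split.
  move=> g; rewrite /sl2_comp /F; do 3![case: ifP => _; first by eexists].
  by [].
rewrite 2!big_cons big_seq1 /F /=.
by apply: sl2P; rewrite /= !mxE /=; ring.
Qed.

Lemma sl2_comp_direct (s : seq int) (F : int -> sl2) : uniq s ->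
  (forall g, sl2_comp g (F g)) -> \sum_(g <- s) F g = 0 ->
  forall g, g \in s -> F g = 0.
Proof.
move=> us Fg F0 g gs; apply/val_inj/matrixP => r c /=; rewrite mxE.
have [grc|] := eqVneq g ((r : nat)%:Z - (c : nat)%:Z); last first.
  by move/sl2_compP: (Fg g); apply.
have := congr1 (fun y => sl2_mx y r c) F0; rewrite /= sl2_mx_sum mxE.
rewrite (bigD1_seq g) //= big1 ?addr0 // => h hg.
by move/sl2_compP: (Fg h); apply; rewrite -grc.
Qed.

Definition sl2_grading : lieGrading int sl2 :=
  LieGrading sl2_comp_subspace sl2_comp_lie sl2_comp_sum sl2_comp_direct.

End Sl2.

(* Main.v *)
Require Import Defs.
From HB Require Import structures.
From mathcomp Require Import all_boot all_order all_algebra.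
From mathcomp Require Import all_classical all_reals all_analysis.
From mathcomp Require Import ring zify lra.
Import Order.TTheory GRing.Theory Num.Theory.
Import numFieldNormedType.Exports.
Local Open Scope ring_scope.

(** Substituting [p (g, i) *: b_g] for the variable [(g, i)], where [b_g] is
    [e], [h] or [f] according to the degree [g], is the most general graded
    substitution into [sl2].  Hence an element of the relatively free algebra
    is determined by its values [relev p] at all points [p] ([relev_inj]), and
    everything is computed inside [sl2]-valued functions of the [3k] scalars
    [a_i = p (-1, i)], [b_i = p (0, i)], [c_i = p (1, i)], for [i < k].

    A Lie word evaluates to a scalar times a monomial in the [a_i], [b_i], [c_i]
    times some [b_g], and since the bracket is graded, the degree in the [c_i]
    minus the degree in the [a_i] is [g] ([word_monomial]).  As [g] takes only
    three useful values, this relation makes one of the [3k] exponents a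
    function of [g] and the others, so words of length at most [m] span at most
    [3 (m+1)^(3k-1)] dimensions ([word_span_bound]).

    Conversely, starting from the variable with value [a_0 e], the operators
    [ad b_j], [ad a_0 o ad c_j] and [ad a_i o ad c_0] multiply an [e]-valued
    element by [2 b_j], [2 a_0 c_j] and [2 a_i c_0] (for [0 < i]) respectively.  These
    [3k-1] multipliers are algebraically independent:
    [a_0] can be set to 1, and the other variables to powers of a parameter [t]
    for which the [j]-th multiplier becomes [2 t^(N^j)].  Applying the [j]-th
    operator as many times as the [j]-th digit of [r] in base [N] produces,
    for each [r < N^(3k-1)], an element of value [2^s t^r e] obtained by words
    of length [O(N)]; over an infinite field these are linearly independent
    ([lin_indep_power_words]).

    Changing the finite generating set rescales word lengths by a constant
    factor, so every finite generating set has growth between two multiples of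
    [m^(3k-1)] and yields the exponent [3k-1] ([GKdim_polynomial]). *)

Set Implicit Arguments.
Unset Strict Implicit.
Unset Printing Implicit Defensive.

(** * Dimension of subspaces of arbitrary vector spaces *)

Section LinearAlgebra.
Local Open Scope classical_set_scope.
Variables (K : fieldType) (V : lmodType K).
Implicit Types (S T : set V).

Lemma lspan_subspace S : is_subspace (lspan S).
Proof.
split=> [T [[]] //|x y Sx Sy T ST|a x Sx T ST]; have [[_ TD TZ] _] := ST.
  by apply: TD; [apply: Sx|apply: Sy].
by apply: TZ; exact: Sx.
Qed.

Lemma lspan_min S T : is_subspace T -> S `<=` T -> lspan S `<=` T.
Proof. exact: smallest_sub. Qed.

Lemma sub_lspan S : S `<=` lspan S.
Proof. exact: sub_gen_smallest. Qed.

Lemma lspanS S T : S `<=` T -> lspan S `<=` lspan T.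
Proof.
by move=> ST; apply: lspan_min; [exact: lspan_subspace|
  exact: subset_trans (@sub_lspan T)].
Qed.

Lemma subspace_comb S (I : finType) (c : I -> K) (b : I -> V) :
  is_subspace S -> (forall i, S (b i)) -> S (\sum_i c i *: b i).
Proof.
by move=> [S0 SD SZ] Sb; apply: big_ind => // i _; apply: SZ.
Qed.

Lemma lspan_rangeP n (b : 'I_n -> V) x :
  lspan (range b) x -> exists c : 'I_n -> K, x = \sum_i c i *: b i.
Proof.
move=> /(_ [set x | exists c : 'I_n -> K, x = \sum_i c i *: b i]); apply; split.
  split=> [|_ _ [c ->] [c' ->]|a _ [c ->]].
  - by exists (fun=> 0); rewrite big1 // => i _; rewrite scale0r.
  - exists (fun i => c i + c' i); rewrite -big_split.
    by apply: eq_bigr => i _; rewrite scalerDl.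
  - exists (fun i => a * c i); rewrite scaler_sumr.
    by apply: eq_bigr => i _; rewrite scalerA.
move=> _ [i _ <-]; exists (fun j => (j == i)%:R).
rewrite (bigD1 i) //= eqxx scale1r big1 ?addr0 // => j /negPf ->.
by rewrite scale0r.
Qed.

(** If the linear relations between the rows of a matrix [C] with [#|I|] columns
    are relations between the [b j], a free family [b] makes the rows of [C]
    independent.  Allowing relations instead of honest coordinates lets the
    lemma be used when only the values of the [b j] have coordinates. *)
Lemma lin_indep_leq_card (I : finType) n (b : 'I_n -> V) (C : 'I_n -> I -> K) :
    lin_indep b ->
    (forall u : 'I_n -> K, (forall i, \sum_j u j * C j i = 0) ->
      \sum_j u j *: b j = 0) ->
  (n <= #|I|)%N.
Proof.
move=> bfree Cb; rewrite leqNgt; apply/negP => In.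
pose M := \matrix_(j < n, i < #|I|) C j (enum_val i).
(* A matrix with more rows than columns has a nonzero left kernel. *)
have /rowV0Pn [u /sub_kermxP uM /eqP[]] : kermx M != 0.
  by rewrite -mxrank_eq0 mxrank_ker subn_eq0 -ltnNge
    (leq_ltn_trans (rank_leq_col M)).
apply/rowP => j; rewrite mxE; apply: (bfree (fun j => u 0 j)).
apply: Cb => i; move/rowP: uM => /(_ (enum_rank i)); rewrite !mxE => uM.
by rewrite -[RHS]uM; apply: eq_bigr => l _; rewrite mxE enum_rankK.
Qed.

Lemma lin_indep_extend n (b : 'I_n -> V) x :
  lin_indep b -> ~ lspan (range b) x ->
  lin_indep (fun i : 'I_n.+1 => if unlift ord0 i is Some j then b j else x).
Proof.
move=> bfree xb c; rewrite big_ord_recl unlift_none.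
under eq_bigr do rewrite liftK.
move=> c0; have cx : c ord0 = 0.
  apply/eqP/negP => /negP cN0; apply: xb.
  have -> : x = - (c ord0)^-1 *: \sum_(i < n) c (lift ord0 i) *: b i.
    apply: (scalerI cN0); rewrite scalerA mulrN divff // scaleN1r.
    by apply/eqP; rewrite -addr_eq0 c0.
  have [_ _] := lspan_subspace (range b); apply.
  apply: subspace_comb; first exact: lspan_subspace.
  by move=> i; apply: sub_lspan; exists i.
rewrite cx scale0r add0r in c0 => i.
by case: (unliftP ord0 i) => [j ->|->//]; apply: (bfree (fun j => c (lift ord0 j))).
Qed.

(** Finite-dimensionality without a basis: this is how upper bounds on dimensions
    are obtained here, and it passes to subspaces for free. *)
Definition indep_bound S (N : nat) : Prop :=
  forall n (b : 'I_n -> V), lin_indep b -> (forall i, S (b i)) -> (n <= N)%N.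

Lemma indep_bound_basis S N : is_subspace S -> indep_bound S N ->
  exists n (b : 'I_n -> V), lin_indep b /\ lspan (range b) = S.
Proof.
move=> Ssub SN.
pose P n := `[< exists b : 'I_n -> V, lin_indep b /\ forall i, S (b i) >].
have P0 : exists n, P n.
  by exists 0%N; apply/asboolP; exists (fun=> 0); split=> [c _ []|[]].
have PN n : P n -> (n <= N)%N by move=> /asboolP [b [bfree /SN]]; apply.
have [n /asboolP [b [bfree Sb]] nmax] := ex_maxnP P0 PN.
exists n, b; split=> //; apply/seteqP; split.
  by apply: lspan_min => // _ [i _ <-].
move=> x Sx; apply: contrapT => /(lin_indep_extend bfree) xbfree.
suff /nmax : P n.+1 by rewrite ltnn.
apply/asboolP; eexists; split; first exact: xbfree.
by move=> i /=; case: (unlift ord0 i).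
Qed.

(** Under an a priori bound, the default value in the definition of [ldim] is
    not reached: a free family of maximal size is a basis. *)
Lemma ldimP S N : is_subspace S -> indep_bound S N ->
  exists b : 'I_(ldim S) -> V, lin_indep b /\ lspan (range b) = S.
Proof.
move=> Ssub /(indep_bound_basis Ssub) Sbasis; rewrite /ldim.
exact: (xgetPex 0%N Sbasis).
Qed.

Lemma ldim_le S N : is_subspace S -> indep_bound S N -> (ldim S <= N)%N.
Proof.
move=> Ssub SN; have [b [bfree bS]] := ldimP Ssub SN.
by apply: SN bfree _ => i; rewrite -bS; apply: sub_lspan; exists i.
Qed.

Lemma ldim_ge S N n (b : 'I_n -> V) : is_subspace S -> indep_bound S N ->
  lin_indep b -> (forall i, S (b i)) -> (n <= ldim S)%N.
Proof.
move=> Ssub SN bfree Sb; have [e [_ eS]] := ldimP Ssub SN.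
have /choice [C bC] : forall j, exists c : 'I_(ldim S) -> K, b j = \sum_i c i *: e i.
  by move=> j; apply: lspan_rangeP; rewrite eS.
rewrite -[leqRHS]card_ord; apply: (lin_indep_leq_card (C := C) bfree) => u uC.
under eq_bigr do rewrite bC scaler_sumr.
rewrite exchange_big big1 // => i _ /=.
under eq_bigr do rewrite scalerA.
by rewrite -scaler_suml uC scale0r.
Qed.
End LinearAlgebra.

(** * Word lengths and change of generators *)

Section WordSpan.
Local Open Scope classical_set_scope.
Variables (K : fieldType) (A : lieAlgType K).
Implicit Types V X : set A.

Definition word_span V (m : nat) : set A :=
  lspan [set x | exists2 n, (n <= m)%N & lie_word V n x].

Lemma word_span_subspace V m : is_subspace (word_span V m).
Proof. exact: lspan_subspace. Qed.

Lemma word_spanS V m n : (m <= n)%N -> word_span V m `<=` word_span V n.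
Proof.
by move=> mn; apply: lspanS => x [l lm wx]; exists l => //; apply: leq_trans mn.
Qed.

Lemma lie_word_span V m x : lie_word V m x -> word_span V m x.
Proof. by move=> wx; apply: sub_lspan; exists m. Qed.

Lemma word_span_lie V m n x y :
  word_span V m x -> word_span V n y -> word_span V (m + n) (lie x y).
Proof.
have [W0 WD WZ] := word_span_subspace V (m + n).
move=> Vx Vy; move: x Vx; apply: lspan_min.
  split=> [|x x' xy x'y|a x xy] /=; first by rewrite lie0l.
    by rewrite lieDl; exact: WD.
  by rewrite lieZl; exact: WZ.
move=> x [i im wx] /=; move: y Vy; apply: lspan_min.
  split=> [|y y' xy xy'|a y xy] /=; first by rewrite lie0r.
    by rewrite lieDr; exact: WD.
  by rewrite lieZr; exact: WZ.
move=> y [j jn wy] /=; apply: sub_lspan; exists (i + j)%N; first exact: leq_add.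
exact: lie_wordM.
Qed.

(** Rewriting each letter as a combination of words of length at most [d]
    multiplies the lengths by at most [d]. *)
Lemma word_span_trans V X d m :
  V `<=` word_span X d -> word_span V m `<=` word_span X (d * m)%N.
Proof.
move=> VX; apply: lspan_min; first exact: word_span_subspace.
move=> x [n nm wx]; apply: (@word_spanS _ (d * n)%N).
  by rewrite leq_mul2l nm orbT.
elim: wx => {x n nm} [v /VX|i j x y _ IHx _ IHy]; first by rewrite muln1.
by rewrite mulnDr; exact: word_span_lie.
Qed.

(** The elements lying in some [word_span X d] form a Lie subalgebra
    containing [X]. *)
Lemma generates_word_span X x : lie_generates X -> exists d, word_span X d x.
Proof.
move=> Xgen; suff : [set x | exists d, word_span X d x] x by [].
have : [set: A] x by [].
rewrite -Xgen; apply; split; last first.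
  by move=> v Xv; exists 1%N; apply: lie_word_span; exact: lie_word1.
split; first split.
- by exists 0%N; have [] := word_span_subspace X 0.
- move=> y z [i Xy] [j Xz]; exists (maxn i j).
  have [_ WD _] := word_span_subspace X (maxn i j).
  by apply: WD; [apply: (@word_spanS _ i)|apply: (@word_spanS _ j)];
    rewrite // ?leq_maxl ?leq_maxr.
- by move=> a y [i Xy]; exists i; have [_ _] := word_span_subspace X i; apply.
- by move=> y z [i Xy] [j Xz]; exists (i + j)%N; exact: word_span_lie.
Qed.

Lemma finite_word_span V X : finite_set V -> lie_generates X ->
  exists2 d, (0 < d)%N & V `<=` word_span X d.
Proof.
move=> /finite_seqP [s ->] Xgen; elim: s => [|v s [d d0 IHs]].
  by exists 1%N => // x; rewrite /= in_nil.
have [i Xv] := generates_word_span v Xgen.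
exists (maxn d i); first by rewrite leq_max d0.
move=> x /=; rewrite inE => /orP[/eqP ->|xs].
  by apply: word_spanS Xv; exact: leq_maxr.
by apply: (@word_spanS _ d); [exact: leq_maxl|exact: IHs].
Qed.

End WordSpan.

(** * Polynomial growth determines the Gelfand-Kirillov dimension *)

Section PolynomialGrowth.
Variable R : realType.
Local Open Scope classical_set_scope.

(** The constants only change [ln (g m)] by a bounded amount, which is negligible
    against [ln m]. *)
Lemma limn_esup_ln_growth (g : nat -> nat) (d C D : nat) :
    (0 < C)%N -> (0 < D)%N ->
    (forall m, (0 < m)%N -> (g m <= C * m ^ d)%N) ->
    (forall m, ((m %/ D) ^ d <= g m)%N) ->
  limn_esup (fun m => (ln (g m)%:R / ln m%:R)%:E) = (d%:R : R)%:E.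
Proof.
move=> C0 D0 gle gge.
suff gcvg : (ln (g m)%:R / ln m%:R : R) @[m --> \oo] --> (d%:R : R).
  have gcvgE : (ln (g m)%:R / ln m%:R)%:E @[m --> \oo] --> (d%:R : R)%:E.
    by apply: cvg_EFin; [exact: nearW|exact: gcvg].
  by have [_ ->] := cvg_limn_einf_sup gcvgE.
(* [ln (g m)] differs from [d * ln m] by at most [B] as soon as [D <= m]. *)
pose B : R := ln C%:R + d%:R * ln (2 * D)%:R.
have lnC : 0 <= ln C%:R :> R by rewrite ln_ge0 // ler1n.
have lnD : 0 <= d%:R * ln (2 * D)%:R :> R.
  by rewrite mulr_ge0 // ln_ge0 // ler1n muln_gt0.
apply/cvgrPdist_le => e e0; near=> m.
have Dm : (D <= m)%N by near: m; exact: nbhs_infty_ge.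
have m2 : (2 <= m)%N by near: m; exact: nbhs_infty_ge.
have m0 : (0 < m)%N by exact: ltnW.
have q0 : (0 < m %/ D)%N by rewrite divn_gt0.
have g0 : (0 < g m)%N by apply: leq_trans (gge m); rewrite expn_gt0 q0.
have lnm0 : 0 < ln m%:R :> R by rewrite ln_gt0 // ltr1n.
have Bm : B <= e * ln m%:R.
  rewrite mulrC -ler_pdivrMr // -(ler_expR) lnK ?posrE ?ltr0n //.
  near: m; exact: nbhs_infty_ger.
have lnX n : (0 < n)%N -> d%:R * ln n%:R = ln (n ^ d)%:R :> R.
  by move=> n0; rewrite natrX lnXn ?ltr0n // mulr_natl.
have up : ln (g m)%:R <= ln C%:R + d%:R * ln m%:R :> R.
  rewrite lnX // -lnM ?posrE ?ltr0n ?expn_gt0 ?m0 // -natrM.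
  by rewrite ler_ln ?posrE ?ltr0n ?muln_gt0 ?C0 ?expn_gt0 ?m0 // ler_nat gle.
have low : d%:R * ln m%:R <= ln (g m)%:R + d%:R * ln (2 * D)%:R :> R.
  apply: (@le_trans _ _ (d%:R * (ln (m %/ D)%:R + ln (2 * D)%:R))).
    rewrite ler_wpM2l // -lnM ?posrE ?ltr0n ?muln_gt0 // -natrM.
    rewrite ler_ln ?posrE ?ltr0n ?muln_gt0 ?q0 // ler_nat.
    (* When [D <= m], the quotient [m %/ D] is at least [m / (2 D)]. *)
    have := ltn_ceil m D0; nia.
  rewrite mulrDr lerD2r lnX // ler_ln ?posrE ?ltr0n ?expn_gt0 ?q0 //.
  by rewrite ler_nat.
have -> : d%:R - ln (g m)%:R / ln m%:R
    = (d%:R * ln m%:R - ln (g m)%:R) / ln m%:R :> R.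
  by rewrite mulrBl mulfK ?gt_eqF.
rewrite normrM normfV [X in _ / X]gtr0_norm // ler_pdivrMr //.
by apply: le_trans Bm; rewrite ler_norml /B; apply/andP; split; lra.
Unshelve. all: by end_near. Qed.

(** The dimension is defined through an unspecified finite generating set, so
    the estimates for [X] have to be transported to every other one. *)
Lemma GKdim_polynomial (K : fieldType) (A : lieAlgType K) (X : set A) (d C D : nat) :
    finite_set X -> lie_generates X -> (0 < d)%N -> (0 < C)%N -> (0 < D)%N ->
    (forall m, (0 < m)%N -> indep_bound (word_span X m) (C * m ^ d)%N) ->
    (forall N, (0 < N)%N -> exists2 b : 'I_(N ^ d) -> A,
      lin_indep b & forall i, word_span X (D * N)%N (b i)) ->
  GKdim A R = (d%:R)%:E.
Proof.
move=> Xfin Xgen d0 C0 D0 Xle Xge; rewrite /GKdim.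
suff VX (V : set A) : finite_set V -> lie_generates V -> GKdim_wrt R V = (d%:R)%:E.
  case: xgetP => [_ _ [V [Vfin Vgen] <-]|/(_ (d%:R)%:E) []]; first exact: VX.
  by exists X => //; exact: VX.
move=> Vfin Vgen.
have [d1 d1_gt0 VX] := finite_word_span Vfin Xgen.
have [d2 d2_gt0 XV] := finite_word_span Xfin Vgen.
have Vle m : (0 < m)%N -> indep_bound (word_span V m) (C * d1 ^ d * m ^ d)%N.
  move=> m0 n b bfree bV; rewrite -mulnA -expnMn.
  apply: (Xle (d1 * m)%N) bfree _; first by rewrite muln_gt0 d1_gt0.
  by move=> i; apply: word_span_trans VX _ (bV i).
apply: (@limn_esup_ln_growth _ d (C * d1 ^ d) (d2 * D)).
- by rewrite muln_gt0 C0 expn_gt0 d1_gt0.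
- by rewrite muln_gt0 d2_gt0.
- by move=> m m0; apply: ldim_le; [exact: word_span_subspace|exact: Vle].
- move=> m; set N := (m %/ _)%N; have [->|N0] := posnP N; first by rewrite exp0n.
  have m0 : (0 < m)%N by move: N0; rewrite /N; case: (m) => //; rewrite div0n.
  have [b bfree bX] := Xge N N0.
  apply: (ldim_ge (word_span_subspace V m) (Vle m m0) bfree) => i.
  apply: (@word_spanS _ _ _ (d2 * (D * N))%N); last first.
    exact: word_span_trans XV _ (bX i).
  by rewrite mulnA mulnC leq_trunc_div.
Qed.
End PolynomialGrowth.

(** * Evaluation of the relatively free algebra in sl2 *)

Section Evaluation.
Local Open Scope classical_set_scope.
Variables (K : fieldType) (k : nat).
Implicit Types (g h : int) (p : int * nat -> K).

Definition sl2_basis g : sl2 K :=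
  if g == -1 then sl2_e K else if g == 0 then sl2_h K
  else if g == 1 then sl2_f K else 0.

Lemma sl2_comp_line g (x : sl2 K) : sl2_comp g x <-> exists a, x = a *: sl2_basis g.
Proof.
rewrite /sl2_comp /sl2_basis; do 3?case: ifP => _; split.
all: try by [move=> [a _ <-]; exists a|move=> [a ->]; exists a].
- by move=> ->; exists 0; rewrite scaler0.
- by move=> [a ->]; rewrite scaler0.
Qed.

(** Each component of the grading is spanned by its basis vector, so the scalar
    exists by gradedness alone. *)
Lemma sl2_basis_lie g h :
  exists c, lie (sl2_basis g) (sl2_basis h) = c *: sl2_basis (g + h).
Proof.
by apply/sl2_comp_line/sl2_comp_lie; apply/sl2_comp_line; exists 1; rewrite scale1r.
Qed.

Lemma sl2_lie_he : lie (sl2_h K) (sl2_e K) = 2 *: sl2_e K.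
Proof.
by apply: sl2P; rewrite /= !mxE !big_ord_recl !big_ord0 !mxE /=; ring.
Qed.

Lemma sl2_lie_efe : lie (sl2_e K) (lie (sl2_f K) (sl2_e K)) = 2 *: sl2_e K.
Proof.
apply: sl2P; rewrite /= !mxE ?big_ord_recl ?big_ord0 !mxE !big_ord_recl !big_ord0.
all: by rewrite !mxE /=; ring.
Qed.

Lemma sl2_e_scale_inj (a : K) : a *: sl2_e K = 0 -> a = 0.
Proof.
by move=> /(congr1 (fun x => sl2_mx x 0 1)); rewrite /= !mxE /= mulr1.
Qed.

Lemma sl2_supportP g : gsupport (sl2_grading K) g <-> g \in [:: -1; 0; 1].
Proof.
have cN0 r c (x : sl2 K) : sl2_mx x r c != 0 -> x != 0.
  by apply: contraNneq => ->; rewrite /= mxE.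
split=> [[x /sl2_comp_line [a ->]]|].
  by rewrite /sl2_basis !inE; do 3?case: ifP => // _; rewrite scaler0 eqxx.
move=> gs; exists (sl2_basis g); first by
  apply/sl2_comp_line; exists 1; rewrite scale1r.
move: gs; rewrite !inE => /or3P[] /eqP ->; rewrite /sl2_basis /=.
- by apply: (cN0 0 1); rewrite /= !mxE /= oner_eq0.
- by apply: (cN0 0 0); rewrite /= !mxE /= subr0 oner_eq0.
- by apply: (cN0 1 0); rewrite /= !mxE /= oner_eq0.
Qed.

Local Notation F := (relfree (sl2_grading K) k).
Local Notation vars := (relvars (sl2_grading K) k).

Definition homog_point p (v : int * nat) : sl2 K := p v *: sl2_basis v.1.

Definition relev p (x : F) : sl2 K := flift (homog_point p) (relvars_incl (repr x)).

Lemma relev_proj p f :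
  relev p (lieProj (relideal (sl2_grading K) k) f)
    = flift (homog_point p) (relvars_incl f).
Proof.
have /lieProj_eqP fid := lieProjK (lieProj (relideal (sl2_grading K) k) f).
have := fid (homog_point p)
  (fun g i => (sl2_comp_line g _).2 (ex_intro _ (p (g, i)) erefl)).
rewrite /relvars_incl -scaleN1r !fliftD !fliftZ scaleN1r => /eqP.
by rewrite subr_eq0 => /eqP.
Qed.

Lemma relevD p x y : relev p (x + y) = relev p x + relev p y.
Proof.
elim/lieProjW: x => x; elim/lieProjW: y => y.
by rewrite -lieProjD !relev_proj /relvars_incl !fliftD.
Qed.

Lemma relevZ p a x : relev p (a *: x) = a *: relev p x.
Proof.
by elim/lieProjW: x => x; rewrite -lieProjZ !relev_proj /relvars_incl !fliftZ.
Qed.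

Lemma relev_lie p x y : relev p (lie x y) = lie (relev p x) (relev p y).
Proof.
elim/lieProjW: x => x; elim/lieProjW: y => y.
by rewrite -lieProj_lie !relev_proj /relvars_incl !flift_lie.
Qed.

Lemma relev0 p : relev p 0 = 0.
Proof. by rewrite -[X in relev p X](scale0r 0) relevZ scale0r. Qed.

Lemma relev_sum p (I : finType) (c : I -> K) (x : I -> F) :
  relev p (\sum_i c i *: x i) = \sum_i c i *: relev p (x i).
Proof.
under [RHS]eq_bigr do rewrite -relevZ.
by apply: (big_morph (relev p) (relevD p) (relev0 p)).
Qed.

Lemma relev_gen p (v : vars) : relev p (relgen v) = p (val v) *: sl2_basis (val v).1.
Proof. by rewrite relev_proj /relvars_incl !flift_gen. Qed.

(** Every graded substitution is of the form [homog_point p]. *)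
Lemma relev_inj x : (forall p, relev p x = 0) -> x = 0.
Proof.
elim/lieProjW: x => x x0; rewrite -lieProj0; apply/lieProj_eqP; rewrite subr0.
move=> s sG.
have /choice [p ps] : forall v : int * nat, exists a, s v = a *: sl2_basis v.1.
  by case=> g i; apply/sl2_comp_line; exact: sG.
by rewrite (_ : s = homog_point p) -?relev_proj //; apply/funext.
Qed.

(** The type of variables consists of pairs with a membership proof; [relgen_at]
    gives access to the generators by plain indices, with 0 as a dummy value. *)
Definition relgen_at g i : F :=
  xget 0 [set x | exists2 v : vars, val v = (g, i) & relgen v = x].

Lemma relgen_atP g i : g \in [:: -1; 0; 1] -> (i < k)%N ->
  exists2 v : vars, val v = (g, i) & relgen v = relgen_at g i.
Proof.
move=> gs ik; apply: (@xgetPex F 0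
  [set x | exists2 v : vars, val v = (g, i) & relgen v = x]).
have gi : vars (g, i) by split=> //=; exact/sl2_supportP.
by exists (relgen (SigSub (mem_set gi))), (SigSub (mem_set gi)).
Qed.

Lemma relgen_at_word g i : g \in [:: -1; 0; 1] -> (i < k)%N ->
  word_span (range (@relgen _ _ _ (sl2_grading K) k)) 1 (relgen_at g i).
Proof.
move=> gs ik; have [v _ <-] := relgen_atP gs ik.
by apply: lie_word_span; apply: lie_word1; exists v.
Qed.

Lemma relev_at p g i : g \in [:: -1; 0; 1] -> (i < k)%N ->
  relev p (relgen_at g i) = p (g, i) *: sl2_basis g.
Proof.
by move=> gs ik; have [v vgi <-] := relgen_atP gs ik; rewrite relev_gen vgi.
Qed.

End Evaluation.

(** * Upper bound: balanced monomials *)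

Section Monomials.
Local Open Scope classical_set_scope.
Variables (K : fieldType) (k : nat).
Local Notation F := (relfree (sl2_grading K) k).
Local Notation X := (range (@relgen _ _ _ (sl2_grading K) k)).
Implicit Types (E : int -> nat -> nat) (p : int * nat -> K).

Definition monomial E p : K :=
  \prod_(g <- [:: -1; 0; 1]) \prod_(i < k) p (g, val i) ^+ E g i.

Lemma monomialD E E' p :
  monomial (fun g i => E g i + E' g i)%N p = monomial E p * monomial E' p.
Proof.
rewrite /monomial -big_split; apply: eq_bigr => g _ /=.
by rewrite -big_split; apply: eq_bigr => i _; rewrite exprD.
Qed.

Lemma eq_monomial E E' p :
    (forall g i, g \in [:: -1; 0; 1] -> (i < k)%N -> E g i = E' g i) ->
  monomial E p = monomial E' p.
Proof.
move=> EE'; rewrite /monomial big_seq [RHS]big_seq.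
by apply: eq_bigr => g gs; apply: eq_bigr => i _; rewrite EE'.
Qed.

Definition total E g : nat := \sum_(i < k) E g i.

(** Both invariants are additive under brackets: exponents add up, and so do the
    degrees [g] by [sl2_basis_lie]. *)
Lemma word_monomial n (x : F) : lie_word X n x ->
  exists q g E, [/\ forall h i, (E h i <= n)%N,
    (total E 1)%:Z = (total E (-1))%:Z + g
    & forall p, relev p x = (q * monomial E p) *: sl2_basis K g].
Proof.
elim=> {n x} [_ [v _ <-]|
  m n x y _ [q [g [E [Em Eg xE]]]] _ [q' [g' [E' [En Eg' yE]]]]].
  have [/sl2_supportP gs ik] : relvars (sl2_grading K) k (val v) by exact: set_valP.
  set g := (val v).1 in gs *; set i := (val v).2 in ik.
  exists 1, g, (fun h j => (h == g) && (j == i)).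
  split=> [h j||p]; first by case: andP.
    have totE h : total (fun h j => (h == g) && (j == i)) h = (h == g).
      rewrite /total (bigD1 (Ordinal ik)) //= eqxx andbT big1 ?addn0 // => j.
      by rewrite -val_eqE /= => /negPf ->; rewrite andbF.
    by rewrite !totE; move: gs; rewrite !inE => /or3P[] /eqP ->.
  rewrite relev_gen mul1r /monomial (bigD1_seq g) //= (bigD1 (Ordinal ik)) //=.
  rewrite !eqxx expr1 !big1 ?mulr1 // => [|h hg|j].
  - by rewrite /g /i -surjective_pairing.
  - by rewrite big1 // => j _; rewrite (negPf hg).
  - by rewrite -val_eqE /= => /negPf ->.
have [s ss] := sl2_basis_lie K g g'.
exists (q * q' * s), (g + g'), (fun h i => E h i + E' h i)%N; split=> [h i||p].
- exact: leq_add.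
- by rewrite /total !big_split /= !PoszD Eg Eg'; ring.
- rewrite relev_lie xE yE lieZl lieZr ss !scalerA monomialD; congr (_ *: _); ring.
Qed.

End Monomials.

Section UpperBound.
Local Open Scope classical_set_scope.
Variables (K : fieldType) (k' m : nat).
Let k := k'.+1.
Local Notation F := (relfree (sl2_grading K) k).
Local Notation X := (range (@relgen _ _ _ (sl2_grading K) k)).
Implicit Types (p : int * nat -> K).

(* An index stores the degree, shifted to [0, 1, 2], and the exponents of all the
   variables but [c_0]: first those of the [a_i], then those of the [b_i], then
   those of the [c_i] for [0 < i]. *)
Let I : finType := ('I_3 * {ffun 'I_(3 * k').+2 -> 'I_m.+1})%type.

Definition code_degree (s : I) : int := (val s.1)%:Z - 1.

(** The missing exponent, that of [c_0], is recovered from the balance between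
    degrees.  For indices that do not come from a word the balance may be
    negative, and the absolute value is then a dummy. *)
Definition code_exponent (s : I) (g : int) (i : nat) : nat :=
  let e j : nat := s.2 (inord j) in
  if g == -1 then e i else if g == 0 then e (k + i)%N
  else if i is j.+1 then e (2 * k + j)%N
  else absz (\sum_(l < k) (e l)%:Z + code_degree s
    - \sum_(l < k') (e (2 * k + l)%N)%:Z)%R.

Lemma code_exponent_surj (E : int -> nat -> nat) (g : int) :
    (forall h i, (E h i <= m)%N) -> g \in [:: -1; 0; 1] ->
    (total k E 1)%:Z = (total k E (-1))%:Z + g ->
  exists2 s : I, code_degree s = g &
    forall h i, h \in [:: -1; 0; 1] -> (i < k)%N -> code_exponent s h i = E h i.
Proof.
move=> Em gs Eg.
pose e (j : 'I_(3 * k').+2) : 'I_m.+1 := inord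
  (if (j < k)%N then E (-1) j else if (j < 2 * k)%N then E 0 (j - k)%N
   else E 1 (j - 2 * k).+1).
have eE j : (j < (3 * k').+2)%N -> [ffun j => e j] (inord j) =
    (if (j < k)%N then E (-1) j else if (j < 2 * k)%N then E 0 (j - k)%N
     else E 1 (j - 2 * k).+1) :> nat.
  by move=> jI; rewrite ffunE /e inordK ?inordK // ltnS; do 2?case: ifP.
pose t : 'I_3 := inord (absz (g + 1)).
have tg : (val t)%:Z - 1 = g.
  by move: gs; rewrite !inE /t => /or3P[] /eqP ->; rewrite /= inordK.
exists (t, [ffun j => e j]) => // h i hs ik.
rewrite /code_exponent /code_degree /= tg.
move: hs; rewrite !inE => /or3P[] /eqP -> /=.
- by rewrite eE ?ik //; lia.
- rewrite eE; last by lia.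
  by rewrite ifF ?ifT ?addKn //; lia.
case: i ik => [_|i ik]; last first.
  rewrite eE; last by lia.
  by rewrite !ifF ?addKn //; lia.
have -> : \sum_(l < k) ([ffun j => e j] (inord l) : nat)%:Z = (total k E (-1))%:Z.
  rewrite /total (big_morph Posz PoszD (erefl 0%:Z)); apply: eq_bigr => l _.
  rewrite eE ?ltn_ord //; last by have := ltn_ord l; lia.
have -> : \sum_(l < k') ([ffun j => e j] (inord (2 * k + l)%N) : nat)%:Z
    = (\sum_(l < k') E 1 l.+1)%:Z.
  rewrite (big_morph Posz PoszD (erefl 0%:Z)); apply: eq_bigr => l _.
  rewrite eE; last by have := ltn_ord l; lia.
  by rewrite !ifF ?addKn //; have := ltn_ord l; lia.
rewrite -Eg /total big_ord_recl /= PoszD addrK; exact: absz_nat.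
Qed.

(** Coordinates are stated for the values at all points [p] simultaneously; this
    is the form that [lin_indep_leq_card] accepts. *)
Lemma word_span_coord (x : F) : word_span X m x ->
  exists u : I -> K, forall p, relev p x =
    \sum_s u s *: (monomial k (code_exponent s) p *: sl2_basis K (code_degree s)).
Proof.
move: x; apply: lspan_min.
  split=> [|x y [u xu] [v yv]|a x [u xu]].
  - by exists (fun=> 0) => p; rewrite relev0 big1 // => s _; rewrite scale0r.
  - exists (fun s => u s + v s) => p; rewrite relevD xu yv -big_split.
    by apply: eq_bigr => s _; rewrite scalerDl.
  - exists (fun s => a * u s) => p; rewrite relevZ xu scaler_sumr.
    by apply: eq_bigr => s _; rewrite -[RHS]scalerA.
move=> x [n nm /word_monomial [q [g [E [En Eg xE]]]]].
have [gs|gNs] := boolP (g \in [:: -1; 0; 1]); last first.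
  exists (fun=> 0) => p; rewrite xE big1 => [|s _]; last by rewrite scale0r.
  move: gNs; rewrite !inE !negb_or => /and3P[/negPf g1 /negPf g2 /negPf g3].
  by rewrite /sl2_basis g1 g2 g3 scaler0.
have [s sg sE] := code_exponent_surj (fun h i => leq_trans (En h i) nm) gs Eg.
exists (fun s' => if s' == s then q else 0) => p.
rewrite (bigD1 s) //= eqxx big1 ?addr0 => [|s' /negPf ->]; last by rewrite scale0r.
by rewrite xE scalerA sg (eq_monomial p sE).
Qed.

Lemma word_span_bound : indep_bound (word_span X m) (3 * m.+1 ^ (3 * k').+2).
Proof.
move=> n b bfree bX; have /choice [C bC] := fun j => word_span_coord (bX j).
have -> : (3 * m.+1 ^ (3 * k').+2)%N = #|I| by rewrite card_prod card_ffun !card_ord.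
apply: (lin_indep_leq_card (C := C) bfree) => u uC; apply: relev_inj => p.
rewrite relev_sum; under eq_bigr do rewrite bC scaler_sumr.
rewrite exchange_big big1 // => s _ /=.
under eq_bigr do rewrite scalerA.
by rewrite -scaler_suml uC scale0r.
Qed.

End UpperBound.

(** * Lower bound: words valued in powers of a parameter *)

Lemma modn_expn_digits N d r :
  (\sum_(j < d) ((r %/ N ^ j) %% N) * N ^ j = r %% N ^ d)%N.
Proof.
elim: d => [|d IHd]; first by rewrite big_ord0 expn0 modn1.
rewrite big_ord_recr /= IHd.
have e1 := divn_eq r (N ^ d).
have e2 := divn_eq (r %/ N ^ d) N.
have e3 := divn_eq r (N ^ d.+1).
rewrite expnSr divnMA in e3 *.
move: e1 e2 e3; set q := (_ %/ _)%N; set s := (q %% N)%N; set q' := (q %/ N)%N.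
nia.
Qed.

Section LowerBound.
Local Open Scope classical_set_scope.
Variables (K : fieldType) (k N : nat).
Hypotheses (k_gt0 : (0 < k)%N) (N_gt0 : (0 < N)%N).
Let d := (3 * k - 1)%N.
Local Notation F := (relfree (sl2_grading K) k).
Local Notation X := (range (@relgen _ _ _ (sl2_grading K) k)).
Local Notation a := (@relgen_at K k (-1)).
Local Notation b := (@relgen_at K k 0).
Local Notation c := (@relgen_at K k 1).

(** For [j] in the three successive ranges of lengths [k], [k] and [k - 1], this is
    multiplication of an [e]-valued element by [2 a_0 c_j], [2 b_(j-k)] and
    [2 a_(j-2k+1) c_0]. *)
Definition mult_step (j : nat) (x : F) : F :=
  if (j < k)%N then lie (a 0) (lie (c j) x)
  else if (j < 2 * k)%N then lie (b (j - k)) x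
  else lie (a (j - 2 * k).+1) (lie (c 0) x).

(** The point at which [mult_step j] is multiplication by [2 t ^+ (N ^ j)].  Since
    [c_0] is set to [t], the exponent of [a_i] with [0 < i] is lowered by 1. *)
Definition power_point (t : K) (v : int * nat) : K :=
  let: (g, i) := v in
  if g == 1 then t ^+ (N ^ i) else if g == 0 then t ^+ (N ^ (k + i))
  else if i is j.+1 then t ^+ (N ^ (2 * k + j) - 1) else 1.

Lemma mult_step_word j n x : (j < d)%N ->
  word_span X n x -> word_span X (n + 2) (mult_step j x).
Proof.
rewrite /d => jd Xx; rewrite /mult_step addnC.
have two g g' i i' : g \in [:: -1; 0; 1] -> g' \in [:: -1; 0; 1] ->
    (i < k)%N -> (i' < k)%N ->
    word_span X (2 + n) (lie (relgen_at K k g i) (lie (relgen_at K k g' i') x)).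
  by move=> gs gs' ik ik'; rewrite -[(2 + n)%N]/(1 + (1 + n))%N;
    do 2?[apply: word_span_lie; first exact: relgen_at_word].
case: ifP => jk; first exact: two.
case: ifP => j2k; last by apply: two => //; lia.
apply: (@word_spanS _ _ _ (1 + n)); first by rewrite leq_add2r.
by apply: word_span_lie => //; apply: relgen_at_word => //; lia.
Qed.

(** The factor 2 comes from [[h, e] = 2 e] and [[e, [f, e]] = 2 e]. *)
Lemma mult_step_eval t j u x : (j < d)%N ->
  relev (power_point t) x = u *: sl2_e K ->
  relev (power_point t) (mult_step j x) = (2 * t ^+ (N ^ j) * u) *: sl2_e K.
Proof.
rewrite /d => jd xu; rewrite /mult_step.
have efe (v w : K) : lie (v *: sl2_e K) (lie (w *: sl2_f K) (u *: sl2_e K))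
    = (2 * (v * w) * u) *: sl2_e K.
  by rewrite lieZl lieZr !lieZl !lieZr sl2_lie_efe !scalerA; congr (_ *: _); ring.
case: ifP => jk.
  by rewrite !relev_lie xu !relev_at //= efe mul1r.
case: ifP => j2k.
  rewrite relev_lie xu relev_at //=; last by lia.
  rewrite lieZl lieZr sl2_lie_he !scalerA subnKC; last by lia.
  by congr (_ *: _); ring.
rewrite !relev_lie xu !relev_at //=; last by lia.
rewrite efe subnKC; last by lia.
rewrite expn0 expr1 -exprSr subn1 prednK //.
by rewrite expn_gt0 N_gt0.
Qed.

Definition digit r j := ((r %/ N ^ j) %% N)%N.

Fixpoint power_word r d' : F :=
  if d' is j.+1 then iter (digit r j) (mult_step j) (power_word r j) else a 0.

Definition digit_sum r d' := (\sum_(j < d') digit r j)%N.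

Lemma power_word_word r d' : (d' <= d)%N ->
  word_span X (1 + 2 * digit_sum r d') (power_word r d').
Proof.
rewrite /digit_sum; elim: d' => [|j IHj] jd /=.
  by rewrite big_ord0; exact: relgen_at_word.
rewrite big_ord_recr /=; elim: (digit r j) => [|n IHn] /=.
  by rewrite addn0; apply: IHj; exact: ltnW.
by move/(mult_step_word jd): IHn; congr word_span; lia.
Qed.

Lemma power_word_eval t r d' : (d' <= d)%N ->
  relev (power_point t) (power_word r d')
    = (2 ^+ digit_sum r d' * t ^+ (r %% N ^ d')) *: sl2_e K.
Proof.
rewrite -modn_expn_digits /digit_sum; elim: d' => [|j IHj] jd /=.
  by rewrite !big_ord0 relev_at //= !mulr1.
rewrite !big_ord_recr /= -/(digit r j); elim: (digit r j) => [|n IHn] /=.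
  by rewrite mul0n !addn0; apply: IHj; exact: ltnW.
rewrite (mult_step_eval jd IHn); congr (_ *: _).
by rewrite addnS mulSn exprS addnCA !exprD; ring.
Qed.

Lemma digit_sum_le r d' : (digit_sum r d' <= d' * (N - 1))%N.
Proof.
rewrite -[X in (_ <= X * _)%N]card_ord -sum_nat_const; apply: leq_sum => j _.
by rewrite /digit; have := ltn_pmod (r %/ N ^ j) N_gt0; lia.
Qed.

(** A linear relation between the words gives, at [power_point t], a polynomial
    of size at most [N ^ d] vanishing at every [t], in particular at the integers
    [0, ..., N ^ d - 1], which are distinct in characteristic 0. *)
Lemma lin_indep_power_words : [pchar K] =i pred0 ->
  exists2 w : 'I_(N ^ d) -> F,
    lin_indep w & forall r, word_span X ((2 * d + 1) * N) (w r).
Proof.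
move=> /pcharf0P charK0; exists (fun r => power_word r d); last first.
  move=> r; apply: (@word_spanS _ _ _ (1 + 2 * digit_sum r d)); last first.
    exact: power_word_word.
  have := digit_sum_le r d; have := N_gt0; nia.
move=> u u0.
pose P : {poly K} := \poly_(r < N ^ d)
  (if insub r is Some s then u s * 2 ^+ digit_sum r d else 0).
have Proot t : root P t.
  apply/eqP/sl2_e_scale_inj; rewrite horner_poly.
  transitivity (relev (power_point t) (\sum_i u i *: power_word i d)); last first.
    by rewrite u0 relev0.
  rewrite relev_sum scaler_suml; apply: eq_bigr => r _.
  rewrite valK power_word_eval // scalerA modn_small //.
  by rewrite mulrA.
have P0 : P = 0.
  apply/eqP; apply: contraTT isT => P_neq0.
  have := max_poly_roots (rs := [seq i%:R | i <- iota 0 (N ^ d)]) P_neq0.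
  rewrite size_map size_iota.
  have -> : all (root P) [seq i%:R | i <- iota 0 (N ^ d)] by apply/allP.
  rewrite map_inj_uniq ?iota_uniq; last first.
    move=> i j ij; wlog le_ij : i j ij / (i <= j)%N => [wlog_ij|].
      by case/orP: (leq_total i j) => le; [|apply/esym]; exact: wlog_ij.
    apply/eqP; rewrite eqn_leq le_ij -subn_eq0 -charK0 natrB //.
    by rewrite ij subrr eqxx.
  move=> /(_ isT isT); rewrite ltnNge => /negP[]; exact: size_poly.
move=> r; have /eqP := congr1 (fun p : {poly K} => p`_r) P0.
rewrite coef0 coef_poly ltn_ord valK mulf_eq0 expf_eq0 charK0 andbF orbF.
by move/eqP.
Qed.

End LowerBound.

(** * The graded Gelfand-Kirillov dimension of sl2 *)

Lemma finite_sl2_support (K : fieldType) : finite_set (gsupport (sl2_grading K)).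
Proof.
rewrite (_ : gsupport _ = [set` [:: -1; 0; 1]]%classic); first exact: finite_seq.
by apply/seteqP; split=> g /sl2_supportP.
Qed.

Unset Implicit Arguments.

Theorem corollary3p9 (R : realType) (K : fieldType) (k : nat)
    (charK0 : [pchar K] =i pred0) (k_ge1 : (1 <= k)%N) :
  graded_GKdim (sl2_grading K) R k = (3 * k%:R - 1)%:E.
Proof.
have -> : 3 * k%:R - 1 = (3 * k - 1)%:R :> R.
  by rewrite natrB ?natrM //; lia.
set d := (3 * k - 1)%N.
apply: (@GKdim_polynomial R K _ (range (@relgen _ _ _ (sl2_grading K) k))
  d (3 * 2 ^ d) (2 * d + 1)).
- exact/relgen_finite/finite_sl2_support.
- exact: relgen_generates.
- by rewrite /d; lia.
- by rewrite muln_gt0 expn_gt0.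
- by rewrite addn1.
- move=> m m_gt0; rewrite /d; case: k k_ge1 {d} => // k' _ n b bfree bX.
  apply: leq_trans (word_span_bound bfree bX) _.
  rewrite (_ : 3 * k'.+1 - 1 = (3 * k').+2)%N; last by lia.
  by rewrite -mulnA leq_mul2l -expnMn leq_exp2r //; lia.
- by move=> N N_gt0; exact: lin_indep_power_words.
Qed.
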